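(* In the $n$-player quantum volunteer's dilemma $G^{(n)}_{\mathrm{QVD}}$, the following strategy profiles are Pareto optimal: (a) $Q^n=(Q,\ldots,Q)\in\Theta^n$ with $Q=\left(0,\frac{\pi}{n}\right)$, for all integers $n\ge2$; (b) $A^n=(A,\ldots,A)\in\Theta^n$ with $A=\left(0,\frac{\pi}{2}\right)$, for all even integers $n\ge2$.
   Context: Notation: $[n]=\{1,\ldots,n\}$; $[P]$ is the Iverson bracket, equal to $1$ if $P$ is true and $0$ otherwise. For $x\in\{0,1\}^n$, $\mathrm{wt}(x)=|\{i\in[n]:x_i=1\}|$ is the Hamming weight and $\bar x$ is the bitwise complement ($\bar x_i=1-x_i$). Deterministic volunteer's dilemma payoffs: for $x\in\{0,1\}^n$ ($x_i=1$ means player $i$ volunteers, $x_i=0$ means player $i$ abstains), $\$_i^{\mathrm{VD}}(x)=2-\frac1{\mathrm{wt}(x)}$ if $x_i=1$, and $\$_i^{\mathrm{VD}}(x)=2\,[\mathrm{wt}(x)>0]$ if $x_i=0$. Quantum volunteer's dilemma $G^{(n)}_{\mathrm{QVD}}$: the $n$-player game in which every player's strategy set is $\Theta=[0,4\pi)\times[0,2\pi)$. Strategy $(\theta_i,\phi_i)\in\Theta$ means that player $i$ applies to qubit $i$ the unitary $$U(\theta_i,\phi_i)=\begin{pmatrix}e^{\mathrm i\phi_i}\cos(\theta_i/2)&\sin(\theta_i/2)\\-\sin(\theta_i/2)&e^{-\mathrm i\phi_i}\cos(\theta_i/2)\end{pmatrix}.$$ Let $J=e^{-\frac{\mathrm i\pi}{4}Y^{\otimes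 n}}=\frac1{\sqrt2}(I-\mathrm iY^{\otimes n})$ with $Y=\begin{pmatrix}0&-\mathrm i\\\mathrm i&0\end{pmatrix}$, and let $|x\rangle$, $x\in\{0,1\}^n$, be the computational basis of $(\mathbb C^2)^{\otimes n}$. For a strategy profile $(\theta,\phi)=((\theta_1,\phi_1),\ldots,(\theta_n,\phi_n))\in\Theta^n$ and $x\in\{0,1\}^n$, the probability that exactly the players $i$ with $x_i=1$ volunteer is $$p_{\theta,\phi}(x)=\left|\langle\bar x|J^\dagger\Big(\bigotimes_{j=1}^nU(\theta_j,\phi_j)\Big)J|0\rangle^{\otimes n}\right|^2,$$ and the payoff function of player $i$ is $\$_i(\theta,\phi)=\sum_{x\in\{0,1\}^n}\$_i^{\mathrm{VD}}(x)\,p_{\theta,\phi}(x)$. For a profile $s=(\theta,\phi)$ write $\$_i(s)=\$_i(\theta,\phi)$. Pareto optimality: a profile $s\in\Theta^n$ is Pareto optimal if for every player $i\in[n]$ and every profile $t\in\Theta^n$: if $\$_i(t)>\$_i(s)$, then there exists $j\in[n]\setminus\{i\}$ such that $\$_j(t)<\$_j(s)$. *)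

(* Defs.v *)
From mathcomp Require Import all_boot all_order all_algebra.
From mathcomp Require Import complex spectral.
From mathcomp Require Import all_classical all_reals all_analysis.

Set Implicit Arguments.
Unset Strict Implicit.
Unset Printing Implicit Defensive.

Import Order.TTheory GRing.Theory Num.Theory.

Local Open Scope complex_scope.
Local Open Scope sesquilinear_scope.
Local Open Scope ring_scope.

(* Strategic games whose [n] players, numbered from 0, share one strategy set. *)
Record game (R : realType) (n : nat) (S : Type) := Game {
  strategies : set S;
  payoff : 'I_n -> ('I_n -> S) -> R }.

Definition is_profile (R : realType) (n : nat) (S : Type) (G : game R n S)
    (s : 'I_n -> S) : Prop :=
  forall i, strategies G (s i).

Definition pareto_optimal (R : realType) (n : nat) (S : Type) (G : game R n S)
    (s : 'I_n -> S) : Prop :=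
  is_profile G s /\
  forall (i : 'I_n) (t : 'I_n -> S), is_profile G t ->
    payoff G i t > payoff G i s ->
    exists2 j : 'I_n, j != i & payoff G j t < payoff G j s.

(* {0,1}^n; in ['I_2], [rev_ord b] is 1 - b. *)
Definition bits (n : nat) := {ffun 'I_n -> 'I_2}.

Definition wt (n : nat) (x : bits n) : nat := #|[set i | x i == 1]|.

Definition bits_compl (n : nat) (x : bits n) : bits n :=
  [ffun i => rev_ord (x i)].

Definition vd_payoff (R : realType) (n : nat) (i : 'I_n) (x : bits n) : R :=
  if x i == 1 then 2 - (wt x)%:R^-1 else 2 * (0 < wt x)%N%:R.

(* (C^2)^{\otimes n} has coordinates indexed by the bit strings, through
   [enum_rank]; the entries of the Kronecker product of 2 x 2 matrices are then
   (x, y) |-> \prod_j (A j) (x j) (y j). *)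
Definition dimH (n : nat) : nat := #|{: bits n}|.

Definition ket (R : realType) (n : nat) (x : bits n) : 'cV[R[i]]_(dimH n) :=
  delta_mx (enum_rank x) 0.

Definition tens (R : realType) (n : nat) (A : 'I_n -> 'M[R[i]]_2) :
    'M[R[i]]_(dimH n) :=
  \matrix_(r, c) \prod_(j < n) A j ((enum_val r : bits n) j) ((enum_val c : bits n) j).

Definition mx2 (T : Type) (a b c d : T) : 'M[T]_2 :=
  \matrix_(i < 2, j < 2)
    if i == 0 then (if j == 0 then a else b) else (if j == 0 then c else d).

Definition expi (R : realType) (t : R) : R[i] := cos t +i* sin t.

Definition pauliY (R : realType) : 'M[R[i]]_2 := mx2 0 (- 'i%C) 'i%C 0.

Definition Ugate (R : realType) (s : R * R) : 'M[R[i]]_2 :=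
  let: (theta, phi) := s in
  mx2 (expi phi * (cos (theta / 2))%:C) (sin (theta / 2))%:C
      (- (sin (theta / 2))%:C) (expi (- phi) * (cos (theta / 2))%:C).

(* e^{- i pi/4 Y^{\otimes n}}, in closed form since (Y^{\otimes n})^2 = I. *)
Definition Jgate (R : realType) (n : nat) : 'M[R[i]]_(dimH n) :=
  ((Num.sqrt 2)^-1)%:C *: (1%:M - 'i%C *: tens (fun _ : 'I_n => pauliY R)).

Definition amplitude (R : realType) (n : nat) (s : 'I_n -> R * R)
    (x : bits n) : R[i] :=
  ((ket R (bits_compl x)) ^t* *m (Jgate R n) ^t* *m
     tens (fun j => Ugate (s j)) *m Jgate R n *m ket R [ffun=> 0]) 0 0.

Definition prob (R : realType) (n : nat) (s : 'I_n -> R * R)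
    (x : bits n) : R :=
  Normc.normc (amplitude s x) ^+ 2.

Definition Theta (R : realType) : set (R * R) :=
  ([set` `[0, 4 * pi[] `*` [set` `[0, 2 * pi[])%classic.

Definition QVD (R : realType) (n : nat) : game R n (R * R) :=
  Game (@Theta R)
       (fun i s => \sum_(x : bits n) vd_payoff R i x * prob s x).

(* Main.v *)
(** A pure profile with at least one volunteer pays the players [2 n - 1] in total,
    whoever volunteers, and the one without volunteers pays nothing. Since the
    outcome probabilities sum to 1 (all gates are unitary), the total payoff of
    a quantum profile is [(2 n - 1) (1 - p 0)], which is maximal, so that the
    profile is Pareto optimal, as soon as the no-volunteer probability [p 0]
    vanishes. For the profiles at hand [tens U] is diagonal and acts on both
    [|0...0>] and [|1...1>] as the same scalar; it hence acts as a scalar on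
    [J |0...0>], and [J^dagger] brings the state back to a multiple of
    [|0...0>], which is measured as "everybody volunteers". *)
Require Import Defs.
From mathcomp Require Import all_boot all_order all_algebra.
From mathcomp Require Import complex spectral.
From mathcomp Require Import all_classical all_reals all_analysis.
From mathcomp Require Import ring lra.

Import Order.TTheory GRing.Theory Num.Theory.

Local Open Scope complex_scope.
Local Open Scope sesquilinear_scope.
Local Open Scope ring_scope.

(** If player [i] gains and no other player loses, the total payoff strictly increases. *)
Lemma pareto_of_max_total (R : realType) (n : nat) (S : Type) (G : game R n S)
    (s : 'I_n -> S) :
  is_profile G s ->
  (forall t, is_profile G t ->
     \sum_i payoff G i t <= \sum_i payoff G i s) ->
  pareto_optimal G s.
Proof.
move=> sP max_s; split=> // i t tP lt_i; apply: contrapT => nex.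
have ge_j j : j != i -> payoff G j s <= payoff G j t.
  by move=> ji; rewrite leNgt; apply/negP => lt_j; apply: nex; exists j.
have := max_s t tP; rewrite leNgt => /negP; apply.
rewrite [ltLHS](bigD1 i) // [ltRHS](bigD1 i) //=.
exact: ltr_leD (ler_sum _ _).
Qed.

(** * Tensor products of one-qubit matrices *)

Section Tensor.
Context {R : realType} {n : nat}.
Implicit Types (A B : 'I_n -> 'M[R[i]]_2) (x y : bits n).

Lemma tens_mul A B : tens A *m tens B = tens (fun j => A j *m B j).
Proof.
apply/matrixP => r c; rewrite !mxE.
under [RHS]eq_bigr do rewrite mxE.
(* Distributing the product over the qubits turns one intermediate bit per factor into a whole bit
   string, the summation index of the product on the left. *)
rewrite bigA_distr_bigA /= (reindex (fun x : bits n => enum_rank x)) /=; last first.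
  exact: (onW_bij _ (enum_rank_bij _)).
apply: eq_bigr => x _; rewrite !mxE enum_rankK -big_split.
by apply: eq_bigr.
Qed.

Lemma tens_adj A : (tens A) ^t* = tens (fun j => (A j) ^t*).
Proof.
apply/matrixP => r c; rewrite !mxE rmorph_prod.
by apply: eq_bigr => j _; rewrite !mxE.
Qed.

Lemma bits_neqP x y : reflect (exists j, x j != y j) (x != y).
Proof.
apply: (iffP idP) => [xy|[j]]; last by apply: contraNneq => ->.
case: (pickP (fun j => x j != y j)) => [j|e]; first by exists j.
by case/eqP: xy; apply/ffunP => j; apply/eqP/negbFE/e.
Qed.

Lemma tens1 : tens (fun _ : 'I_n => 1%:M : 'M[R[i]]_2) = 1%:M.
Proof.
apply/matrixP => r c; rewrite !mxE; have [->|rc] := eqVneq r c.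
  by apply: big1 => j _; rewrite mxE eqxx.
have /bits_neqP[j jP] : enum_val r != enum_val c :> bits n.
  by rewrite (inj_eq enum_val_inj).
by rewrite (bigD1 j) //= mxE (negPf jP) mul0r.
Qed.

Lemma tens_unitary A :
  (forall j, A j \is unitarymx) -> tens A \is unitarymx.
Proof.
move=> Au; apply/unitarymxP; rewrite tens_adj tens_mul -tens1.
by congr tens; apply: funext => j; apply/unitarymxP.
Qed.

(** The hypothesis leaves column [x j] of each factor supported in row [y j]. This covers diagonal
    gates, with [y = x], as well as [pauliY], which flips the bit. *)
Lemma tens_ket A x y :
  (forall j b, b != y j -> A j b (x j) = 0) ->
  tens A *m ket R x = (\prod_j A j (y j) (x j)) *: ket R y.
Proof.
move=> A0; rewrite /ket -colE; apply/matrixP => r c.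
rewrite !mxE enum_rankK ord1 eqxx andbT.
have [->|ry] := eqVneq r (enum_rank y).
  by rewrite enum_rankK mulr1.
rewrite mulr0.
have /bits_neqP[j jP] : enum_val r != y.
  by apply: contraNneq ry => <-; rewrite enum_valK.
by rewrite (bigD1 j) //= A0 // mul0r.
Qed.

End Tensor.

(** * One-qubit gates and phases *)

Lemma mx2_mul (T : pzSemiRingType) (a b c d a' b' c' d' : T) :
  mx2 a b c d *m mx2 a' b' c' d' =
  mx2 (a * a' + b * c') (a * b' + b * d') (c * a' + d * c') (c * b' + d * d').
Proof.
apply/matrixP => r s; rewrite !mxE big_ord_recl big_ord1 !mxE /=.
by case: (r == 0); case: (s == 0).
Qed.

Lemma mx2_adj (C : numClosedFieldType) (a b c d : C) :
  (mx2 a b c d) ^t* = mx2 (a^*)%R (c^*)%R (b^*)%R (d^*)%R.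
Proof.
by apply/matrixP => r s; rewrite !mxE; case: (r == 0); case: (s == 0).
Qed.

Lemma mx2_1 (T : pzSemiRingType) : mx2 1 0 0 1 = 1%:M :> 'M[T]_2.
Proof.
apply/matrixP => r s; rewrite !mxE.
by case: r => -[|[|]] // ?; case: s => -[|[|]] // ?.
Qed.

Lemma Ugate_unitary (R : realType) (s : R * R) : Ugate s \is unitarymx.
Proof.
case: s => t p; apply/unitarymxP.
rewrite mx2_adj mx2_mul -mx2_1; congr mx2; apply/eqP; rewrite eq_complex /=;
  rewrite ?cosN ?sinN; apply/andP; split; apply/eqP.
all: have := cos2Dsin2 p; have := cos2Dsin2 (t / 2).
all: move: (cos p) (sin p) (cos (t / 2)) (sin (t / 2)) => a b c d cd ab.
(* Where the right-hand side is 1, it is rewritten as [(a ^+ 2 + b ^+ 2) * c ^+ 2 + d ^+ 2], which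
   makes the identity polynomial. *)
all: by [ring | rewrite -cd -[c ^+ 2]mul1r -ab; ring].
Qed.

Lemma pauliY_herm (R : realType) : (pauliY R) ^t* = pauliY R.
Proof.
by rewrite mx2_adj; congr mx2; apply/eqP; rewrite eq_complex /= ?oppr0 ?opprK !eqxx.
Qed.

Lemma pauliY_sqr (R : realType) : pauliY R *m pauliY R = 1%:M.
Proof.
rewrite mx2_mul -mx2_1; congr mx2; rewrite ?mulr0 ?mul0r ?addr0 ?add0r //.
  by rewrite mulNr -expr2 sqr_i opprK.
by rewrite mulrN -expr2 sqr_i opprK.
Qed.

Lemma expiXn (R : realType) (t : R) k : expi t ^+ k = expi (t *+ k).
Proof.
elim: k => [|k IH]; first by rewrite mulr0n /expi cos0 sin0.
rewrite exprS IH mulrS /expi cosD sinD; apply/eqP.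
by rewrite eq_complex /= eqxx addrC [X in _ + X]mulrC eqxx.
Qed.

Lemma sin_mulrn_pi (R : realType) k : sin (pi *+ k : R) = 0.
Proof.
elim: k => [|k IH]; first by rewrite sin0.
by rewrite mulrSr sinDpi IH oppr0.
Qed.

(** * Outcome probabilities and total payoff *)

Section Protocol.
Context {R : realType} {n : nat}.
Implicit Types (s : 'I_n -> R * R) (x y : bits n).

(** The tensor power [T] of [pauliY] is Hermitian with square 1, so (1 - iT)(1 + iT) = 1 + T^2 = 2,
    which the two factors 1/sqrt 2 cancel. *)
Lemma Jgate_unitary : Jgate R n \is unitarymx.
Proof.
apply/unitarymxP; set T := tens (fun _ : 'I_n => pauliY R).
have TT : T *m T = 1%:M.
  by rewrite tens_mul -tens1; congr tens; apply: funext => j; rewrite pauliY_sqr.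
have Tadj : T ^t* = T.
  by rewrite tens_adj; congr tens; apply: funext => j; rewrite pauliY_herm.
have -> : (Jgate R n) ^t* = ((Num.sqrt 2)^-1)%:C *: (1%:M + 'i%C *: T).
  have -> : 1%:M + 'i%C *: T = (1%:M - 'i%C *: T) ^t*.
    rewrite -{1}Tadj; apply/matrixP => r c; rewrite !mxE rmorphB rmorphM eq_sym /=.
    have -> : Num.conj ('i%C : R[i]) = - 'i%C.
      by apply/eqP; rewrite eq_complex /= oppr0 !eqxx.
    by rewrite mulNr opprK rmorph_nat.
  by apply/matrixP => r c; rewrite !mxE rmorphM; congr (_ * _); apply: conjc_real.
rewrite /Jgate -/T -scalemxAl -scalemxAr scalerA.
rewrite mulmxDl !mulmxDr !mul1mx mulmx1 mulNmx -scalemxAl -scalemxAr TT.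
rewrite scalerA -['i%C * 'i%C]expr2 sqr_i.
rewrite scaleN1r opprK addrA addrK -mulr2n -[1%:M *+ 2]scaler_nat scalerA.
rewrite -rmorphM -expr2 exprVn sqr_sqrtr ?ler0n //.
by rewrite -(rmorph_nat (real_complex R)) -rmorphM mulVf ?pnatr_eq0 ?scale1r.
Qed.

Definition evolution s : 'M[R[i]]_(dimH n) :=
  (Jgate R n) ^t* *m tens (fun j => Ugate (s j)) *m Jgate R n.

Lemma evolution_unitary s : evolution s \is unitarymx.
Proof.
rewrite !mul_unitarymx ?trmxC_unitary ?Jgate_unitary //.
by apply: tens_unitary => j; apply: Ugate_unitary.
Qed.

Definition bits0 : bits n := [ffun=> 0].

Lemma amplitudeE s x :
  amplitude s x = (evolution s *m ket R bits0) (enum_rank (bits_compl x)) 0.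
Proof.
rewrite /amplitude /ket trmx_delta map_delta_mx -!mulmxA -rowE mxE.
by rewrite /evolution !mulmxA.
Qed.

Lemma bits_complK : involutive (@bits_compl n).
Proof. by move=> x; apply/ffunP => j; rewrite !ffunE rev_ordK. Qed.

Lemma sum_prob s : \sum_x prob s x = 1.
Proof.
apply: (fmorph_inj (real_complex R)).
rewrite rmorph_sum rmorph1 /=.
transitivity (\sum_r `|(evolution s *m ket R bits0) r 0| ^+ 2).
  rewrite (reindex (fun x => enum_rank (bits_compl x))) /=.
    by apply: eq_bigr => x _; rewrite /prob amplitudeE rmorphXn.
  apply/onW_bij/(bij_comp (enum_rank_bij _)).
  exact: inv_bij bits_complK.
(* [unitarymxP] speaks of rows; applied to the adjoint, it gives the norm of a column. *)
have /unitarymxP : (evolution s)^t* \is unitarymx.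
  by rewrite trmxC_unitary evolution_unitary.
rewrite trmxCK => /matrixP/(_ (enum_rank bits0) (enum_rank bits0)).
rewrite !mxE eqxx /= => normE.
apply: etrans normE; apply: eq_bigr => r _.
by rewrite -colE !mxE mulrC -normCK.
Qed.

(** As soon as somebody volunteers, everybody receives 2 and the volunteers share equally a total
    cost of 1. *)
Lemma sum_vd_payoff x :
  \sum_i vd_payoff R i x = (n.*2%:R - 1) * (x != bits0)%:R.
Proof.
have [->|/bits_neqP[j jP]] := eqVneq x bits0.
  rewrite mulr0; apply: big1 => i _; rewrite /vd_payoff ffunE /=.
  by rewrite /wt eq_card0 ?mulr0 // => k; rewrite inE ffunE.
have wt0 : (0 < wt x)%N.
  apply/card_gt0P; exists j; rewrite inE.
  by move: jP; rewrite ffunE; case: (x j) => -[|[|]].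
rewrite mulr1 /vd_payoff wt0 mulr1.
transitivity (\sum_(i < n) (2 - (if x i == 1 then (wt x)%:R^-1 else 0) : R)).
  by apply: eq_bigr => i _; case: ifP; rewrite ?subr0.
rewrite big_split /= sumrN -big_mkcond sumr_const card_ord -mulrnA mul2n.
congr (_ - _).
rewrite sumr_const -[LHS]mulr_natr.
have <- : wt x = #|[pred i | x i == 1]| by rewrite /wt cardsE.
by rewrite mulVf // pnatr_eq0 -lt0n.
Qed.

Lemma sum_payoff s :
  \sum_i payoff (QVD R n) i s = (n.*2%:R - 1) * (1 - prob s bits0).
Proof.
rewrite exchange_big /=.
under eq_bigr do rewrite -mulr_suml sum_vd_payoff.
have -> : 1 - prob s bits0 = \sum_(x | x != bits0) prob s x.
  by rewrite -(sum_prob s) (bigD1 bits0) //= addrAC subrr add0r.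
rewrite (bigD1 bits0) //= eqxx mulr0 mul0r add0r mulr_sumr.
by apply: eq_bigr => x x0; rewrite x0 mulr1.
Qed.

Lemma prob_ge0 s x : 0 <= prob s x.
Proof. by rewrite exprn_even_ge0. Qed.

Lemma pareto_of_prob0 s :
  (0 < n)%N -> is_profile (QVD R n) s -> prob s bits0 = 0 ->
  pareto_optimal (QVD R n) s.
Proof.
move=> n_gt0 sP s0; apply: (pareto_of_max_total _ _ _ _ _ sP) => t _.
apply: (@le_trans _ _ (n.*2%:R - 1)).
  (* Having at least one player makes the factor 2n - 1 nonnegative. *)
  rewrite sum_payoff ler_piMr ?lerBlDr ?lerDl ?prob_ge0 // subr_ge0 ler1n.
  by rewrite double_gt0.
by rewrite sum_payoff s0 subr0 mulr1.
Qed.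

(** At angle 0 the gate is diagonal with entries e^(i phi) and e^(-i phi). The all-zeros and
    all-ones kets thus get the phases e^(i n phi) and e^(-i n phi), which agree because sin(n phi) =
    0. *)
Lemma prob0_phase (phi : R) :
  (0 < n)%N -> sin (phi *+ n) = 0 -> prob (fun _ : 'I_n => (0, phi)) bits0 = 0.
Proof.
move=> n0 sin0n; rewrite /prob amplitudeE /evolution.
set D := tens _.
pose b1 : bits n := [ffun=> 1].
have DE (b : 'I_2) :
    D *m ket R [ffun=> b] = expi (phi *+ n) *: ket R [ffun=> b].
  rewrite (tens_ket _ _ [ffun=> b]) => [|j c]; last first.
    rewrite !ffunE !mxE mul0r sin0 oppr0.
    by case: b c => -[|[|]] // ? [[|[|]] // ?].
  congr (_ *: _); under eq_bigr do rewrite !ffunE !mxE mul0r cos0 !mulr1.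
  rewrite prodr_const card_ord.
  case: b => -[|[|]] //= ?; rewrite expiXn //.
  by rewrite mulNrn /expi cosN sinN sin0n oppr0.
have JE : exists a b : R[i],
    Jgate R n *m ket R bits0 = a *: ket R bits0 + b *: ket R b1.
  rewrite /Jgate -scalemxAl mulmxBl mul1mx -scalemxAl (tens_ket _ _ b1).
    by rewrite scalerBr !scalerA -scaleNr; do 2 eexists; reflexivity.
  by move=> j b; rewrite !ffunE !mxE; case: b => -[|[|]].
have DJ : D *m (Jgate R n *m ket R bits0) =
    expi (phi *+ n) *: (Jgate R n *m ket R bits0).
  case: JE => a [b ->]; rewrite mulmxDr -!scalemxAr !DE scalerDr !scalerA.
  by rewrite mulrC [b * _]mulrC.
have /unitarymxP : (Jgate R n) ^t* \is unitarymx.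
  by rewrite trmxC_unitary Jgate_unitary.
rewrite trmxCK => JJ.
rewrite -(mulmxA _ _ (ket R bits0)) -(mulmxA _ D) DJ.
rewrite -scalemxAr mulmxA JJ mul1mx !mxE (inj_eq enum_rank_inj).
(* The no-volunteer amplitude is read at the all-ones string, where a multiple of [ket R bits0] has
   entry 0; the two strings differ since [n] is positive. *)
rewrite (_ : bits_compl bits0 == bits0 = false) ?mulr0 ?Normc.normc0 ?expr0n //.
by apply/negbTE/bits_neqP; exists (Ordinal n0); rewrite !ffunE.
Qed.

End Protocol.

Theorem corollary12 (R : realType) :
  (forall n : nat, (2 <= n)%N ->
     pareto_optimal (QVD R n) (fun _ : 'I_n => (0, pi / n%:R))) /\
  (forall n : nat, (2 <= n)%N -> ~~ odd n ->
     pareto_optimal (QVD R n) (fun _ : 'I_n => (0, pi / 2))).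
Proof.
have profile (n : nat) (phi : R) : 0 <= phi < 2 * pi ->
    is_profile (QVD R n) (fun _ : 'I_n => (0, phi)).
  move=> phi_itv i; split; rewrite /= inE /= in_itv //=.
  by rewrite lexx mulr_gt0 ?pi_gt0.
have pi0 := pi_gt0 R.
split=> n n2 => [|even_n]; (have n0 : (0 < n)%N by exact: leq_trans n2);
  apply: pareto_of_prob0 => //.
- apply: profile; rewrite divr_ge0 ?ler0n ?ltW //= ltr_pdivrMr ?ltr0n //.
  have : (2 : R) <= n%:R by rewrite ler_nat.
  nra.
- by apply: prob0_phase => //; rewrite -[_ *+ n]mulr_natr divfK ?sinpi //
     pnatr_eq0 -lt0n.
- by apply: profile; lra.
- apply: prob0_phase => //.
  (* Evenness makes the phase n pi/2 an integer multiple of pi. *)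
  rewrite -(even_halfK even_n) -mul2n mulrnA -[_ *+ 2]mulr_natr.
  rewrite divfK ?pnatr_eq0 //.
  exact: sin_mulrn_pi.
Qed.
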